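(* LLRK schemes of the form $$\widetilde{\mathbf{y}}_{n+1}=\widetilde{\mathbf{y}}_n+\widetilde{\boldsymbol{\phi}}(t_n,\widetilde{\mathbf{y}}_n;h_n)+\widetilde{\boldsymbol{\rho}}(t_n,\widetilde{\mathbf{y}}_n;h_n),$$ with $\widetilde{\boldsymbol{\phi}}$ computed by $(p,q)$-Padé approximation with scaling and squaring as described in the context, are A-stable if the $(p,q)$-Padé approximation is taken with $p\le q\le p+2$. Moreover, if $q=p+1$ or $q=p+2$, then such LLRK schemes are also L-stable.
   Context: For an autonomous ODE $\mathbf{x}'=\mathbf{f}(\mathbf{x})$ in dimension $d$ (the test equation is scalar and complex, $d=1$), $$\widetilde{\boldsymbol{\phi}}(t_n,\widetilde{\mathbf{y}}_n;\delta)=\mathbf{L}\left(\mathbf{P}_{p,q}(2^{-\kappa}\widetilde{\mathbf{D}}_n\delta)\right)^{2^{\kappa}}\mathbf{r},\qquad\widetilde{\mathbf{D}}_n=\begin{bmatrix}\mathbf{f}_{\mathbf{x}}(\widetilde{\mathbf{y}}_n)&\mathbf{f}(\widetilde{\mathbf{y}}_n)\\0&0\end{bmatrix},$$ $\mathbf{L}=[\mathbf{I}_d\ \ \mathbf{0}_{d\times1}]$, $\mathbf{r}^\top=[\mathbf{0}_{1\times d}\ \ 1]$, and $\kappa$ (denoted $\kappa_n$ when $\delta=h_n$) is the smallest non-negative integer such that $\Vert2^{-\kappa}\widetilde{\mathbf{D}}_n\delta\Vert\le\frac12$ in an induced matrix norm. $\mathbf{P}_{p,q}(z)=\mathbf{N}_{p,q}(z)/\mathbf{D}_{p,q}(z)$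 is the $(p,q)$-Padé approximation to $e^z$ (numerator degree $p$, denominator degree $q$): $$\mathbf{N}_{p,q}(z)=1+\frac{p}{q+p}z+\frac{p(p-1)}{(q+p)(q+p-1)}\frac{z^2}{2!}+\dots+\frac{p(p-1)\cdots1}{(q+p)\cdots(q+1)}\frac{z^p}{p!},\qquad\mathbf{D}_{p,q}(z)=\mathbf{N}_{q,p}(-z).$$ $\widetilde{\boldsymbol{\rho}}$ is the increment of an explicit $s$-stage Runge-Kutta scheme with coefficients $c_i,a_{ij},b_j$: $\widetilde{\boldsymbol{\rho}}(t_n,\widetilde{\mathbf{y}}_n;h_n)=h_n\sum_{j=1}^sb_j\widetilde{\mathbf{k}}_j$, $\widetilde{\mathbf{k}}_i=\widetilde{\mathbf{q}}(\widetilde{\mathbf{y}}_n;c_ih_n,h_n\sum_{j=1}^{i-1}a_{ij}\widetilde{\mathbf{k}}_j)$, where $$\widetilde{\mathbf{q}}(\widetilde{\mathbf{y}}_n;\delta,\boldsymbol{\xi})=\mathbf{f}(\widetilde{\mathbf{y}}_n+\widetilde{\boldsymbol{\phi}}(t_n,\widetilde{\mathbf{y}}_n;\delta)+\boldsymbol{\xi})-\mathbf{f}_{\mathbf{x}}(\widetilde{\mathbf{y}}_n)\widetilde{\boldsymbol{\phi}}(t_n,\widetilde{\mathbf{y}}_n;\delta)-\mathbf{f}(\widetilde{\mathbf{y}}_n).$$ A-stable: applied to the scalar test equation $x'=\lambda x$, $\lambda\in\mathbb{C}$, $\Re\lambda\le0$, with any step $h_n>0$, the scheme gives $\widetilde{y}_{n+1}=R\,\widetilde{y}_n$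 with $|R|\le1$ (where $R$ may depend on $\lambda$, $h_n$ and, through $\kappa_n$, on $\widetilde{y}_n$). L-stable: A-stable and, in addition, $R\to0$ as $|h_n\lambda|\to\infty$ (with $\Re\lambda\le0$ and $\widetilde{y}_n$ fixed). *)

(* Defs.v *)
From HB Require Import structures.
From mathcomp Require Import all_boot all_order all_algebra.
From mathcomp Require Import boolp classical_sets reals topology normedtype.
From mathcomp Require Import derive complex.

Set Implicit Arguments.
Unset Strict Implicit.
Unset Printing Implicit Defensive.

Import Order.TTheory GRing.Theory Num.Theory.
Import numFieldNormedType.Exports.

Local Open Scope classical_set_scope.
Local Open Scope complex_scope.
Local Open Scope ring_scope.

(* Complex numbers over [R], seen as a [numFieldType] so that [C] and the
   matrices over [C] carry the topology used by the (complex) derivative. *)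
Definition Cfield (R : realType) : numFieldType := R[i].

(** * Padé approximants of the exponential *)

Definition pade_num (K : fieldType) (p q : nat) : {poly K} :=
  \poly_(j < p.+1) ((p ^_ j)%:R / ((q + p) ^_ j)%:R / (j`!)%:R).

Definition pade_den (K : fieldType) (p q : nat) : {poly K} :=
  pade_num K q p \Po (- 'X).

Definition pade_mx (K : fieldType) (p q n : nat) (A : 'M[K]_n.+1) : 'M[K]_n.+1 :=
  horner_mx A (pade_num K p q) *m invmx (horner_mx A (pade_den K p q)).

(** * Induced matrix norms *)

Record vector_norm (R : realType) (n : nat) := VectorNorm {
  vnorm :> 'cV[Cfield R]_n -> R ;
  vnorm_ge0 : forall x, 0 <= vnorm x ;
  vnorm_eq0 : forall x, vnorm x = 0 -> x = 0 ;
  vnormZ : forall a x, vnorm (a *: x) = complex.Re `|a| * vnorm x ;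
  vnormD : forall x y, vnorm (x + y) <= vnorm x + vnorm y }.

Definition induced_norm (R : realType) n (N : vector_norm R n)
    (A : 'M[Cfield R]_n) : R :=
  sup [set N (A *m x) / N x | x in [set x | x != 0]].

Lemma kappa_exists (R : realType) n (N : vector_norm R n) (A : 'M[Cfield R]_n) :
  exists k : nat, induced_norm N ((2 ^- k)%:C *: A) <= 2^-1.
Proof.
pose S (B : 'M[Cfield R]_n) := [set N (B *m x) / N x | x in [set x | x != 0]].
have [[M SM]|unbA] := pselect (has_ubound (S A)); last first.
  exists 0%N; rewrite expr0 invr1 scale1r /induced_norm sup_out ?invr_ge0 //.
  by case=> _ /unbA.
pose k := (Num.bound (`|M| * 2)).
exists k; rewrite /induced_norm -/(S _).
have [->|S0] := eqVneq (S ((2 ^- k)%:C *: A)) set0.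
  by rewrite sup0 invr_ge0.
apply: ge_sup; first exact/set0P.
move=> _ [x x0 <-]; rewrite -scalemxAl vnormZ -mulrA.
have -> : complex.Re `|(2 ^- k)%:C : Cfield R| = 2 ^- k.
  by rewrite ger0_norm //= lecR invr_ge0 exprn_ge0.
rewrite mulrC ler_pdivrMr ?exprn_gt0 //.
apply: (@le_trans _ _ `|M|).
  by apply: le_trans (ler_norm M); apply: SM; exists x.
rewrite -ler_pdivrMl ?invr_gt0 // invrK mulrC.
apply: le_trans (ltW (archi_boundP _)) _; first by rewrite mulr_ge0.
by rewrite -natrX ler_nat ltnW // ltn_expl.
Qed.

(** * Local linearization with scaling and squaring *)

Definition kappa (R : realType) n (N : vector_norm R n) (A : 'M[Cfield R]_n) :
  nat := ex_minn (kappa_exists N A).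

Section LLRK.
Variables (R : realType) (d : nat).
Local Notation C := (Cfield R).

(* The state space is C^(d+1): the dimension is written [d.+1] so that square
   matrices form nontrivial rings. *)
Local Notation state := 'cV[C]_d.+1.

Definition jacobian_mx (f : state -> state) (y : state) : 'M[C]_d.+1 :=
  \matrix_(i, j) 'D_(delta_mx j 0) (fun u : state => f u i 0) y.

Definition ll_mx (f : state -> state) (y : state) : 'M[C]_(d.+1 + 1) :=
  block_mx (jacobian_mx f y) (f y) 0 0.

Variables (p q : nat) (N : vector_norm R (d.+1 + 1)).

Definition ll_phi (f : state -> state) (y : state) (delta : R) : state :=
  let A := delta%:C *: ll_mx f y in
  let k := kappa N A in
  row_mx 1%:M 0
    *m (@pade_mx C p q (d + 1) ((2 ^- k)%:C *: A) ^+ (2 ^ k) : 'M_(d.+1 + 1))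
    *m col_mx 0 1%:M.

Definition ll_q (f : state -> state) (y : state) (delta : R) (xi : state) :
    state :=
  f (y + ll_phi f y delta + xi) - jacobian_mx f y *m ll_phi f y delta - f y.

Variables (s : nat) (c b : 'I_s -> R) (a : 'M[R]_s).

Definition rk_stage_step (f : state -> state) (y : state) (h : R)
    (k : 'I_s -> state) (i : 'I_s) : state :=
  ll_q f y (c i * h) (h%:C *: \sum_(j < s | (j < i)%N) (a i j)%:C *: k j).

(* Stage [i] only depends on the stages [j < i], so [s] sweeps from any
   starting value reach the unique solution of the stage equations. *)
Definition rk_stage (f : state -> state) (y : state) (h : R) : 'I_s -> state :=
  iter s (rk_stage_step f y h) (fun=> 0).

Lemma rk_stageE f y h i :
  rk_stage f y h i = rk_stage_step f y h (rk_stage f y h) i.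
Proof.
have ext k k' (j : 'I_s) : (forall l : 'I_s, (l < j)%N -> k l = k' l) ->
    rk_stage_step f y h k j = rk_stage_step f y h k' j.
  move=> kk'; rewrite /rk_stage_step; congr (ll_q _ _ _ (_ *: _)).
  by apply: eq_bigr => l lj; rewrite kk'.
have stable m : forall j : 'I_s, (j < m)%N ->
    iter m.+1 (rk_stage_step f y h) (fun=> 0) j =
    iter m (rk_stage_step f y h) (fun=> 0) j.
  elim: m => [//|m IHm] j jm.
  by apply: ext => l lj; apply: IHm; apply: leq_trans lj _.
by symmetry; exact: (stable s i (ltn_ord i)).
Qed.

Definition rk_rho (f : state -> state) (y : state) (h : R) : state :=
  h%:C *: \sum_(j < s) (b j)%:C *: rk_stage f y h j.

Definition LLRK (f : state -> state) (h : R) (y : state) : state :=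
  y + ll_phi f y h + rk_rho f y h.

End LLRK.

(** * Linear stability *)

Section Stability.
Variable R : realType.
Local Notation C := (Cfield R).

(* A one-step scheme for scalar complex equations maps a right-hand side [f], a
   step [h] and the current value to the next value. *)
Local Notation scheme := (('cV[C]_1 -> 'cV[C]_1) -> R -> 'cV[C]_1 -> 'cV[C]_1).

Definition stability_factor (Phi : scheme) (F : C -> R -> 'cV[C]_1 -> C) : Prop :=
  forall (l : C) (h : R) (y : 'cV[C]_1), complex.Re l <= 0 -> 0 < h ->
    Phi (fun x => l *: x) h y = F l h y *: y.

Definition contractive (F : C -> R -> 'cV[C]_1 -> C) : Prop :=
  forall (l : C) (h : R) (y : 'cV[C]_1), complex.Re l <= 0 -> 0 < h ->
    `|F l h y| <= 1.

Definition damping (F : C -> R -> 'cV[C]_1 -> C) : Prop :=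
  forall (y : 'cV[C]_1) (eps : R), 0 < eps -> exists M : R,
    forall (l : C) (h : R), complex.Re l <= 0 -> 0 < h ->
      M%:C < `|h%:C * l| -> `|F l h y| < eps%:C.

Definition A_stable (Phi : scheme) : Prop :=
  exists F, stability_factor Phi F /\ contractive F.

Definition L_stable (Phi : scheme) : Prop :=
  exists F, [/\ stability_factor Phi F, contractive F & damping F].

End Stability.

(* Main.v *)
Require Import Defs.
From mathcomp Require Import all_boot all_order all_algebra.
From mathcomp Require Import boolp classical_sets reals topology normedtype.
From mathcomp Require Import sequences derive complex.
From mathcomp Require Import ring lra zify.

(** On the test equation all Runge-Kutta stages vanish, so one step multiplies
    [y] by [R(w)^(2^k)], where [w = h l / 2^k] and [R = N/D] is the Padé
    approximant. The linearization matrix has eigenvalue [w] and its induced norm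
    is finite, so the choice of [k] forces [|w| <= 1/2]: only stability of [R] on
    the half-disc [|w| <= 1/2], [Re w <= 0] matters.

    On the imaginary axis [|D|^2 - |N|^2 = c Im(w)^(2q)] with [c >= 0], and
    [c > 0] when [p < q]: [D(x) D(-x) - N(x) N(-x)] is even, of degree at most
    [2q], and by Kummer's equation it vanishes to order [p + q + 1] at [0]. Inside
    the half-disc [|D|^2 - |N|^2] grows at least linearly in [-Re w], because
    there [D] and [N] are close to [exp (- q w / (p+q))] and
    [exp (p w / (p+q))].

    As [|h l|] grows, the minimality of [k] keeps [|w|] bounded below, hence
    [|R(w)|] bounded away from [1], while [2^k] tends to infinity. *)

(** * Padé polynomials and Kummer's equation *)

Section PadePolynomials.
Import Order.TTheory GRing.Theory Num.Theory.
Local Open Scope ring_scope.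

Variable K : numFieldType.
Implicit Types (p q j : nat) (P : {poly K}).

Lemma coef_pade_num p q j :
  (pade_num K p q)`_j = (p ^_ j)%:R / ((q + p) ^_ j)%:R / (j`!)%:R.
Proof.
rewrite coef_poly; case: ltnP => // pj.
by rewrite ffact_small // !mul0r.
Qed.

Lemma size_pade_num p q : (size (pade_num K p q) <= p.+1)%N.
Proof. exact: size_poly. Qed.

Lemma coef_comp_polyNX P j : (P \Po - 'X)`_j = (-1) ^+ j * P`_j.
Proof.
rewrite coef_comp_poly.
under eq_bigr => i _ do
  rewrite exprNn -(rmorphN1 (@polyC K)) -rmorphXn coefCM coefXn mulrCA.
have [Pj|Pj] := ltnP j (size P); last first.
  rewrite (nth_default _ Pj) mulr0 big1 // => i _.
  by rewrite gtn_eqF ?mulr0 // (leq_trans (ltn_ord i)).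
rewrite (bigD1 (Ordinal Pj)) //= eqxx !mulr1 big1 ?addr0 // => i.
by rewrite -val_eqE /= eq_sym => /negPf ->; rewrite !mulr0.
Qed.

Lemma size_comp_polyNX P : size (P \Po - 'X) = size P.
Proof. by rewrite size_comp_poly2 // size_polyN size_polyX. Qed.

Lemma deriv_comp_polyNX P : (P \Po - 'X)^`() = - (P^`() \Po - 'X).
Proof. by rewrite deriv_comp derivN derivX mulrN1. Qed.

Lemma comp_polyNXK P : (P \Po - 'X) \Po - 'X = P.
Proof. by rewrite -comp_polyA raddfN /= comp_polyX opprK comp_polyXr. Qed.

(** Term ratio of the Kummer series 1F1(-p; -(p+q); x), cross-multiplied so that it also covers j >=
    p, where both sides vanish. *)
Lemma coef_pade_numS p q j :
  (j.+1%:R * (j%:R - (p + q)%:R)) * (pade_num K p q)`_j.+1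
  = (j%:R - p%:R) * (pade_num K p q)`_j.
Proof.
rewrite !coef_pade_num !ffactnSr factS addnC.
have [jp|pj|->] := ltngtP j p; last 2 first.
- by rewrite !(ffact_small pj) !mul0n !mul0r !mulr0.
- by rewrite subnn muln0 subrr !mul0r mulr0.
have jn : (j <= p + q)%N by lia.
have h1 : ((p + q) ^_ j)%:R != 0 :> K by rewrite pnatr_eq0 -lt0n ffact_gt0.
have h2 : (p + q)%:R - j%:R != 0 :> K.
  by rewrite -natrB // pnatr_eq0; lia.
have h3 : (j`!)%:R != 0 :> K by rewrite pnatr_eq0 -lt0n fact_gt0.
have h4 : j.+1%:R != 0 :> K by rewrite pnatr_eq0.
rewrite addnC in h2 h1 jn *.
rewrite !natrM !natrB // ?(ltnW jp) //.
move: h1 h2 h3 h4; move: (_ ^_ j)%:R ((_ + _) ^_ _)%:R (q + p)%:R j%:R j.+1%:R p%:R (j`!)%:R.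
move=> a b n j0 j1 p0 f hb hn hf hj.
by field; rewrite hb hn hf hj.
Qed.

(** Kummer's equation with parameters -p and -(p+q), read off coefficientwise from
    [coef_pade_numS]. *)
Lemma pade_num_ode p q : let P := pade_num K p q in
  'X * P^`()^`() = ((p + q)%:R%:P + 'X) * P^`() - p%:R%:P * P.
Proof.
move=> P; apply/polyP => j.
have := coef_pade_numS p q j; rewrite -/P [(_ + 'X) * _]mulrDl.
rewrite !(coefXM, coefB, coefD, coefCM, coef_deriv).
case: j => [|j] /=.
  rewrite !mulr1n mul1r !sub0r mulNr => e.
  by rewrite addr0 -mulNr -e; ring.
rewrite -!(mulr_natl P`_(_)) -!(mulr_natl (_ * _)) => e.
set n := (p + q)%:R in e *.
have -> : n * (j.+2%:R * P`_j.+2) + j.+1%:R * P`_j.+1 - p%:R * P`_j.+1 =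
   n * (j.+2%:R * P`_j.+2) + (j.+1%:R - p%:R) * P`_j.+1 by ring.
rewrite -e; ring.
Qed.

(** Obtained from the equation of [pade_num q p] by substituting -x for x. Equivalently, e^x D
    solves the same equation as N. *)
Lemma pade_den_ode p q : let Q := pade_den K p q in
  'X * Q^`()^`() = ((p + q)%:R%:P - 'X) * Q^`() + q%:R%:P * Q.
Proof.
rewrite /= /pade_den.
have := congr1 (comp_poly (- 'X)) (pade_num_ode q p).
rewrite /= comp_polyB !comp_polyM comp_polyD !comp_polyC comp_polyX.
rewrite !deriv_comp_polyNX derivN deriv_comp_polyNX opprK addnC.
rewrite mulNr => /(congr1 -%R); rewrite opprK => ->.
by rewrite opprB mulrN addrC.
Qed.

(** Coefficient j satisfies (j - n) P_j = 0, so in characteristic zero only j = n survives. *)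
Lemma euler_eigenpoly n P : 'X * P^`() = n%:R%:P * P -> P = P`_n *: 'X^n.
Proof.
move=> e; apply/polyP => j; rewrite coefZ coefXn.
have [->|jn] := eqVneq j n; first by rewrite mulr1.
have /(congr1 (fun Q : {poly K} => Q`_j)) := e.
rewrite mulr0 coefXM coefCM coef_deriv.
have -> : (if (j == 0)%N then 0 else P`_j.-1.+1 *+ j.-1.+1) = j%:R * P`_j.
  by case: j {jn} => [|j] /=; rewrite ?mul0r // mulr_natl.
move/eqP; rewrite -subr_eq0 -mulrBl mulf_eq0 subr_eq0 eqr_nat (negPf jn) /=.
by move/eqP.
Qed.

(* The Wronskian of two solutions of Kummer's equation, [N] and [e^x D]. *)
Lemma pade_wronskian p q : exists c : K,
  pade_num K p q * pade_den K p q + pade_num K p q * (pade_den K p q)^`()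
  - (pade_num K p q)^`() * pade_den K p q = c *: 'X^(p + q).
Proof.
set P := pade_num K p q; set Q := pade_den K p q.
set G := (X in exists c, X = _); exists G`_(p + q).
(* Abel's identity: x G' = (p+q) G, since Kummer's equations eliminate the second derivatives. *)
apply: euler_eigenpoly; rewrite /G !poly.derivE.
have eP := pade_num_ode p q; have eQ := pade_den_ode p q.
rewrite /= -/P -/Q !(natrD, polyCD) in eP eQ *.
transitivity ('X * (P^`() * Q) + 'X * (P * Q^`()) + P * ('X * Q^`()^`())
   - ('X * P^`()^`()) * Q); first by ring.
by rewrite eP eQ; ring.
Qed.

(** The E-polynomial of the approximant: at x = i y it equals |D|^2 - |N|^2, because for real
    coefficients conjugation amounts to x -> -x. *)
Definition pade_stability_poly p q : {poly K} :=
  pade_den K p q * (pade_den K p q \Po - 'X)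
  - pade_num K p q * (pade_num K p q \Po - 'X).

Lemma pade_stability_poly_low p q j : (j <= p + q)%N ->
  (pade_stability_poly p q)`_j = 0.
Proof.
rewrite /pade_stability_poly.
set P := pade_num K p q; set Q := pade_den K p q.
set P' := P \Po _; set Q' := Q \Po _; set F := _ - _.
have [c G] := pade_wronskian p q.
have G' := congr1 (comp_poly (- 'X)) G.
rewrite -/P -/Q in G G'.
rewrite comp_polyB comp_polyD !comp_polyM comp_polyZ comp_Xn_poly -/P' -/Q' in G'.
have dP : P'^`() = - (P^`() \Po - 'X) := deriv_comp_polyNX P.
have dQ : Q'^`() = - (Q^`() \Po - 'X) := deriv_comp_polyNX Q.
(* The derivative of F / (Q Q') with denominators cleared; the Wronskian identity at x and at -x
   supplies the factor x^(p+q). *)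
have key : Q * Q' * F^`() = (Q * Q')^`() * F
  + 'X^(p + q) * (c *: (Q' * P' - (-1) ^+ (p + q) * (Q * P))).
  have -> : 'X^(p + q) * (c *: (Q' * P' - (-1) ^+ (p + q) * (Q * P)))
     = (c *: 'X^(p + q)) * (Q' * P') - (c *: (- 'X) ^+ (p + q)) * (Q * P).
    by rewrite (exprNn 'X) -!mul_polyC; ring.
  by rewrite -G -G' /F !poly.derivE dP dQ; ring.
have Q0 : (Q * Q')`_0 = 1.
  rewrite coef0M !coef_comp_polyNX !coef_pade_num !ffactn0 fact0 !expr0 !mul1r.
  by rewrite !invr1 ?mulr1.
have P0 : (P * P')`_0 = 1.
  rewrite coef0M !coef_comp_polyNX !coef_pade_num !ffactn0 fact0 !expr0 !mul1r.
  by rewrite !invr1 ?mulr1.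
elim/ltn_ind: j => -[|j] IH jn; first by rewrite coefB Q0 P0 subrr.
(* As Q Q' has constant coefficient 1, coefficient j of [key] isolates (j+1) F_(j+1); the other
   terms only involve F_i with i <= j, known to vanish. *)
have /(congr1 (fun Q : {poly K} => Q`_j)) := key.
rewrite coefD coefXnM jn addr0 !coefM.
rewrite big_ord_recl Q0 subn0 mul1r big1 ?addr0; last first.
  move=> [i ij] _; rewrite lift0 coef_deriv IH ?mul0rn ?mulr0 //=; last first.
  - by lia.
  - by lia.
rewrite big1; last first.
  by move=> [i ij] _; rewrite IH ?mulr0 //=; lia.
by rewrite coef_deriv => /eqP; rewrite mulrn_eq0 => /eqP.
Qed.

Lemma pade_stability_poly_even p q :
  pade_stability_poly p q \Po - 'X = pade_stability_poly p q.
Proof.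
rewrite /pade_stability_poly; move: (pade_den K p q) (pade_num K p q) => Q P.
by rewrite comp_polyB !comp_polyM !comp_polyNXK [Q * _]mulrC [P * _]mulrC.
Qed.

Lemma coefM_top (P Q : {poly K}) m n :
  (size P <= m.+1)%N -> (size Q <= n.+1)%N ->
  (P * Q)`_(m + n) = P`_m * Q`_n.
Proof.
move=> Pm Qn; rewrite coefM.
have mmn : (m < (m + n).+1)%N by lia.
rewrite (bigD1 (Ordinal mmn)) //= addKn big1 ?addr0 // => -[i imn].
rewrite -val_eqE /= => im.
have [mi|im'] := ltnP m i.
  by rewrite (nth_default 0 (leq_trans Pm mi)) mul0r.
rewrite [Q`__]nth_default ?mulr0 //; apply: leq_trans Qn _; lia.
Qed.

Lemma size_polyM_leq (P Q : {poly K}) m n :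
  (size P <= m.+1)%N -> (size Q <= n.+1)%N -> (size (P * Q)%R <= (m + n).+1)%N.
Proof.
move=> Pm Qn; apply: leq_trans (size_polyMleq _ _) _.
by rewrite -subn1 leq_subLR add1n -addSn -addnS leq_add.
Qed.

Lemma size_pade_den p q : (size (pade_den K p q) <= q.+1)%N.
Proof. by rewrite size_comp_polyNX size_pade_num. Qed.

(** Only degrees above p + q and at most 2q can survive. As q <= p + 2, these are at most 2q and the
    odd degree p + q + 1, which evenness excludes. For p < q the product of the N has degree below
    2q, so the top coefficient comes from D alone. *)
Lemma pade_stability_polyE p q : (p <= q <= p + 2)%N ->
  pade_stability_poly p q =
  ((p < q)%:R * (-1) ^+ q * (pade_num K q p)`_q ^+ 2) *: 'X^(q + q).
Proof.
case/andP=> pq qp2; apply/polyP => j; rewrite coefZ coefXn.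
have sz : (size (pade_stability_poly p q) <= (q + q).+1)%N.
  rewrite (leq_trans (size_polyD _ _)) // geq_max size_polyN.
  apply/andP; split.
    apply: size_polyM_leq; first exact: size_pade_den.
    by rewrite (size_comp_polyNX (pade_den K p q)) size_pade_den.
  apply: leq_trans (size_polyM_leq _ _ p p _ _) _.
  - exact: size_pade_num.
  - by rewrite size_comp_polyNX size_pade_num.
  - by rewrite ltnS leq_add.
have [->|jq] := eqVneq; last first.
  rewrite mulr0.
  have [jn|nj] := leqP j (p + q); first exact: pade_stability_poly_low.
  have [qj|jq'] := ltnP (q + q) j.
    by rewrite nth_default // (leq_trans sz).
  have oj : odd j.
    suff -> : j = (p + q).+1 by rewrite /= oddD; lia.
    lia.
  have := coef_comp_polyNX (pade_stability_poly p q) j.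
  rewrite pade_stability_poly_even -signr_odd oj expr1 mulN1r => /eqP.
  by rewrite -subr_eq0 opprK -mulr2n mulrn_eq0 => /eqP.
rewrite mulr1; have [{}pq|qp] := ltnP p q; last first.
  rewrite !mul0r pade_stability_poly_low //; lia.
rewrite mul1r coefB (coefM_top _ _ _ _ (size_pade_den p q)); last first.
  by rewrite (size_comp_polyNX (pade_den K p q)) size_pade_den.
rewrite [X in _ - X]nth_default; last first.
  apply: leq_trans (size_polyM_leq _ _ p p _ _) _.
  - exact: size_pade_num.
  - by rewrite size_comp_polyNX size_pade_num.
  - by rewrite -addSn leq_add // ltnW.
by rewrite subr0 comp_polyNXK coef_comp_polyNX expr2 mulrA.
Qed.

End PadePolynomials.

(** * Complex estimates *)

Section ComplexEstimates.
Import Order.TTheory GRing.Theory Num.Theory Normc.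
Local Open Scope complex_scope.
Local Open Scope ring_scope.

Lemma exp_sum_le (R : realFieldType) (s : R) m : 0 <= s <= 1 / 2%:R ->
  \sum_(i < m) s ^+ i / i`!%:R <= 1 + s + 2%:R / 3%:R * s ^+ 2.
Proof.
move=> /andP[s0 s1].
(* Twice the next term is carried along to absorb the tail: one step costs a factor 2s/(n+4) <= 1.
   The constant 2/3 comes from the base case, s^3/3 <= s^2/6. *)
have key n : \sum_(i < n.+3) s ^+ i / i`!%:R
    + 2%:R * s ^+ n.+3 / n.+3`!%:R <= 1 + s + 2%:R / 3%:R * s ^+ 2.
  elim: n => [|n IH].
    rewrite !big_ord_recl big_ord0 /= !factS fact0 /=.
    nra.
  apply: le_trans IH; rewrite big_ord_recr /= -addrA lerD2l.
  rewrite (exprS _ n.+3) (factS n.+3) natrM.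
  have f0 : n.+3`!%:R != 0 :> R by rewrite pnatr_eq0 -lt0n fact_gt0.
  have n0 : n.+4%:R != 0 :> R by rewrite pnatr_eq0.
  have -> : 2%:R * (s * s ^+ n.+3) / (n.+4%:R * n.+3`!%:R) =
            (2%:R * s / n.+4%:R) * (s ^+ n.+3 / n.+3`!%:R).
    by rewrite invfM; ring.
  have t0 : 0 <= s ^+ n.+3 / n.+3`!%:R by rewrite divr_ge0 ?exprn_ge0.
  have c1 : 2%:R * s / n.+4%:R <= 1.
    rewrite ler_pdivrMr ?ltr0n // mul1r.
    have : 1 <= n.+4%:R :> R by rewrite ler1n.
    lra.
  move: t0 c1; rewrite -[2%:R * s ^+ n.+3 / _]mulrA.
  by move: (s ^+ n.+3 / _) (2%:R * s / _) => a b; nra.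
have le_m k : (m <= k)%N -> \sum_(i < m) s ^+ i / i`!%:R
    <= \sum_(i < k) s ^+ i / i`!%:R.
  move=> mk; rewrite -(subnKC mk) big_split_ord /= lerDl sumr_ge0 // => i _.
  by rewrite divr_ge0 ?exprn_ge0.
apply: le_trans (le_m _ (leq_addl 3 m)) _.
apply: le_trans (key m); rewrite lerDl.
by apply: divr_ge0 => //; apply: mulr_ge0 => //; apply: exprn_ge0.
Qed.

Variable R : rcfType.
Implicit Types (w v z : R[i]) (P : {poly R[i]}).

Lemma normCE z : `|z| = (normc z)%:C.
Proof. by []. Qed.

Lemma normc_ge0 z : 0 <= normc z.
Proof. by rewrite -ler0c -normCE. Qed.

Lemma normcX z n : normc (z ^+ n) = normc z ^+ n.
Proof. by elim: n => [|n IH]; rewrite ?normc1 // !exprS normcM IH. Qed.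

Lemma ler_normc_sum (I : finType) (f : I -> R[i]) :
  normc (\sum_i f i) <= \sum_i normc (f i).
Proof.
elim/big_ind2: _ => [|x a y b xa yb|//]; first by rewrite normc0.
by apply: le_trans (le_normcD _ _) _; apply: lerD.
Qed.

Lemma normc_subrXX_le w v r n : normc w <= r -> normc v <= r ->
  normc (w ^+ n.+1 - v ^+ n.+1) <= n.+1%:R * normc (w - v) * r ^+ n.
Proof.
move=> wr vr; have r0 : 0 <= r := le_trans (normc_ge0 _) wr.
rewrite subrXX normcM [n.+1%:R * _]mulrC -mulrA ler_wpM2l ?normc_ge0 //.
apply: le_trans (ler_normc_sum _ _) _.
rewrite -[n.+1 in leRHS]card_ord mulr_natl -sumr_const ler_sum // => -[i ni] _ /=.
rewrite normcM !normcX.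
have -> : r ^+ n = r ^+ (n.+1.-1 - i) * r ^+ i by rewrite -exprD; congr (_ ^+ _); lia.
by rewrite ler_pM ?exprn_ge0 ?normc_ge0 // lerXn2r ?nnegrE ?normc_ge0.
Qed.

Lemma sum_exp_tail_le (s : R) m : 0 <= s <= 1 / 2%:R ->
  \sum_(i < m) s ^+ i.+1 / i.+1`!%:R <= s + 2%:R / 3%:R * s ^+ 2.
Proof.
move=> s01; have := exp_sum_le R s m.+1 s01; rewrite big_ord_recl /= expr0 fact0 divr1.
by rewrite -addrA lerD2l.
Qed.

(** * Polynomials dominated coefficientwise by exp(t x) *)

Section CoefficientBound.
Variables (P : {poly R[i]}) (t : R).
Hypothesis t01 : 0 <= t <= 1.
Hypothesis Pt : forall i, normc P`_i <= t ^+ i / i`!%:R.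

Let s01 : 0 <= t / 2%:R <= 1 / 2%:R.
Proof. by case/andP: t01 => t0 t1; apply/andP; split; lra. Qed.

(** The bound is s + 2s^2/3 at s = t/2, which dominates the partial sums of exp(s) - 1. *)
Lemma normc_horner_subl_le w : normc w <= 1 / 2%:R ->
  normc (P.[w] - P`_0) <= t / 2%:R + t ^+ 2 / 6%:R.
Proof.
move=> w2; rewrite (@horner_coef_wide _ (size P).+1) ?leqnSn // big_ord_recl.
rewrite expr0 mulr1 addrAC subrr add0r.
apply: le_trans (ler_normc_sum _ _) _.
have -> : t / 2%:R + t ^+ 2 / 6%:R
   = t / 2%:R + 2%:R / 3%:R * (t / 2%:R) ^+ 2 by field.
apply: le_trans (sum_exp_tail_le _ (size P) s01); apply: ler_sum => i _.
rewrite lift0 normcM normcX exprMn mulrAC ler_pM ?exprn_ge0 ?normc_ge0 //.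
by rewrite -[2^-1]mul1r lerXn2r ?nnegrE ?normc_ge0 ?(le_trans _ w2) ?normc_ge0.
Qed.

(** The difference of the (i+2)-th powers is at most (i+2) |w - v| / 2^(i+1). The factor i+2 lowers
    the factorial, which leaves t |w - v| times the series of exp(t/2) - 1. *)
Lemma normc_horner_taylor1_le w v : normc w <= 1 / 2%:R ->
  normc v <= 1 / 2%:R ->
  normc (P.[w] - P.[v] - P`_1 * (w - v))
  <= t * normc (w - v) * (t / 2%:R + t ^+ 2 / 6%:R).
Proof.
move=> w2 v2; rewrite !(@horner_coef_wide _ (size P).+2) ?(ltnW (leqnSn _)) //.
rewrite -sumrB !big_ord_recl /= !expr0 !expr1 subrr add0r mulrBr addrAC subrr add0r.
apply: le_trans (ler_normc_sum _ _) _.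
have -> : t / 2%:R + t ^+ 2 / 6%:R
   = t / 2%:R + 2%:R / 3%:R * (t / 2%:R) ^+ 2 by field.
apply: le_trans (_ : t * normc (w - v) *
    (\sum_(i < size P) (t / 2%:R) ^+ i.+1 / i.+1`!%:R) <= _); last first.
  rewrite ler_wpM2l ?sum_exp_tail_le // mulr_ge0 ?normc_ge0 //.
  by case/andP: t01.
rewrite mulr_sumr; apply: ler_sum => i _.
rewrite -mulrBr normcM /bump !add1n.
apply: le_trans (_ : t ^+ i.+2 / i.+2`!%:R *
   (i.+2%:R * normc (w - v) * (1 / 2%:R) ^+ i.+1) <= _).
  by rewrite ler_pM ?normc_ge0 // normc_subrXX_le.
rewrite (factS i.+1) natrM (exprS t) !div1r exprMn.
have f0 : i.+1`!%:R != 0 :> R by rewrite pnatr_eq0 -lt0n fact_gt0.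
have n0 : i.+2%:R != 0 :> R by rewrite pnatr_eq0.
rewrite le_eqVlt; apply/orP; left; apply/eqP.
move: f0 n0; move: i.+1`!%:R i.+2%:R (t ^+ i.+1) (_ ^+ i.+1) (normc _).
by move=> a b c d e a0 b0; field; rewrite a0 b0.
Qed.

End CoefficientBound.

Lemma sqr_normcE z : normc z ^+ 2 = complex.Re z ^+ 2 + complex.Im z ^+ 2.
Proof. by case: z => a b; rewrite sqr_sqrtr // addr_ge0 ?sqr_ge0. Qed.

Lemma normc_Re_le z : `|complex.Re z| <= normc z.
Proof. by rewrite -lecR; exact: normc_ge_Re. Qed.

Lemma normc_Im_le z : `|complex.Im z| <= normc z.
Proof. by case: z => a b; rewrite -sqrtr_sqr ler_wsqrtr // lerDr sqr_ge0. Qed.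

(* From [|a|^2 - |b|^2 = Re ((a - b) * (a + b)^* )]. *)
Lemma sqr_normc_sub_ge (a b : R[i]) (x e : R) : 0 <= x -> 0 <= e ->
  normc (a - b - x%:C) <= x * e -> normc (a - 1) <= e -> normc (b - 1) <= e ->
  2%:R * x * (2%:R - (1 + e) ^+ 2) <= normc a ^+ 2 - normc b ^+ 2.
Proof.
move=> x0 e0 h1 h2 h3.
set r := a - b - x%:C in h1; set u := (a - 1) + (b - 1).
have hu : normc u <= 2%:R * e by apply: le_trans (le_normcD _ _) _; lra.
(* Expansion with a - b = x + r and a + b = 2 + u. Then |r| <= x e and |u| <= 2e give the lower
   bound 2x (1 - 2e - e^2). *)
have -> : normc a ^+ 2 - normc b ^+ 2 =
    2%:R * x + x * complex.Re u + 2%:R * complex.Re r + complex.Re (r * u^*).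
  rewrite !sqr_normcE /u /r; case: a {h1 h2 h3 r u hu} b => a1 a2 [b1 b2] /=.
  ring.
have := normc_Re_le u; have := normc_Re_le r; have := normc_Re_le (r * u^*).
have nJ : normc u^* = normc u by case: (u) => ? ? /=; rewrite sqrrN.
rewrite normcM nJ !ler_norml => /andP[c1 _] /andP[c2 _] /andP[c3 _].
have := normc_ge0 r; have := normc_ge0 u => u0 r0.
have : normc r * normc u <= x * e * (2%:R * e) by rewrite ler_pM.
have : x * (- (2%:R * e)) <= x * complex.Re u by rewrite ler_wpM2l //; lra.
move: (x * complex.Re u) (complex.Re r) (complex.Re (_ * _)) (normc r * _) c1 c2 => A B C D.
nra.
Qed.

End ComplexEstimates.

(** * Stability of the approximant on the half-disc *)

Section LocalStability.
Import Order.TTheory GRing.Theory Num.Theory Normc.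
Local Open Scope complex_scope.
Local Open Scope ring_scope.

Lemma map_pade_num (K L : fieldType) (f : {rmorphism K -> L}) p q :
  map_poly f (pade_num K p q) = pade_num L p q.
Proof.
apply/polyP => j; rewrite coef_map !coef_poly /=; case: ifP => _; last exact: rmorph0.
by rewrite !fmorph_div !rmorph_nat.
Qed.

Lemma map_pade_den (K L : fieldType) (f : {rmorphism K -> L}) p q :
  map_poly f (pade_den K p q) = pade_den L p q.
Proof. by rewrite map_comp_poly map_pade_num rmorphN /= map_polyX. Qed.

(** Factor by factor, (p - i)/(n - i) <= p/n. *)
Lemma ffact_ratio_le (p n j : nat) : (p <= n)%N ->
  (p ^_ j * n ^ j <= p ^ j * n ^_ j)%N.
Proof.
move=> pn; elim: j => // j IH.
rewrite !ffactnSr !expnSr mulnACA [leqRHS]mulnACA leq_mul //.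
by rewrite mulnBl mulnBr leq_sub2l // mulnC leq_mul2l pn orbT.
Qed.

Lemma horner_pade_stability_poly (K : numFieldType) p q (z : K) :
  (pade_stability_poly K p q).[z] =
  (pade_den K p q).[z] * (pade_den K p q).[- z]
  - (pade_num K p q).[z] * (pade_num K p q).[- z].
Proof.
rewrite /pade_stability_poly; move: (pade_den K p q) (pade_num K p q) => Q P.
by rewrite hornerD hornerN !hornerM !horner_comp hornerN hornerX.
Qed.

Variable R : rcfType.
Implicit Types (w z : R[i]).

Lemma normc_real (x : R) : normc x%:C = `|x|.
Proof. by rewrite /= expr0n addr0 sqrtr_sqr. Qed.

(** This makes N an instance of [CoefficientBound] with t = p/(p+q). When p + q = 0 the quotient is
    0 by convention, and only j = 0 matters. *)
Lemma normc_coef_pade_num_le p q j :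
  normc (pade_num R[i] p q)`_j <= (p%:R / (p + q)%:R) ^+ j / j`!%:R.
Proof.
rewrite -(map_pade_num _ _ (real_complex R)) coef_map normc_real.
rewrite coef_pade_num addnC ger0_norm ?divr_ge0 //.
rewrite ler_wpM2r ?invr_ge0 //.
have [pj|jp] := ltnP p j.
  by rewrite ffact_small // mul0r exprn_ge0 // divr_ge0.
have [pq0|pq0] := posnP (p + q).
  have -> : j = 0%N by lia.
  by rewrite !ffactn0 expr0 divr1.
rewrite expr_div_n ler_pdivrMr ?ltr0n ?ffact_gt0; last by lia.
rewrite mulrAC ler_pdivlMr ?exprn_gt0 ?ltr0n //.
by rewrite -!natrX -!natrM ler_nat ffact_ratio_le ?leq_addr.
Qed.

Lemma normc_coef_pade_den_le p q j :
  normc (pade_den R[i] p q)`_j <= (q%:R / (p + q)%:R) ^+ j / j`!%:R.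
Proof.
rewrite coef_comp_polyNX normcM normcX normcN normc1 expr1n mul1r.
by rewrite addnC normc_coef_pade_num_le.
Qed.

Lemma pade_num_conj p q z :
  ((pade_num R[i] p q).[z])^* = (pade_num R[i] p q).[z^*].
Proof. by rewrite -[in RHS](map_pade_num _ _ (@conjc R)) horner_map. Qed.

Lemma pade_den_conj p q z :
  ((pade_den R[i] p q).[z])^* = (pade_den R[i] p q).[z^*].
Proof. by rewrite -[in RHS](map_pade_den _ _ (@conjc R)) horner_map. Qed.

(** The sign of (i y)^(2q) = (-1)^q y^(2q) cancels the one in [pade_stability_polyE]. *)
Lemma pade_imaginary_axis p q (y : R) : (p <= q <= p + 2)%N ->
  normc (pade_den R[i] p q).[0 +i* y] ^+ 2
  - normc (pade_num R[i] p q).[0 +i* y] ^+ 2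
  = (p < q)%N%:R * (pade_num R q p)`_q ^+ 2 * y ^+ (q + q).
Proof.
move=> pq; apply: complexI; rewrite rmorphB 2!rmorphXn 2!rmorphM !rmorphXn /=.
have sqrE z : (normc z)%:C ^+ 2 = z * z^* by rewrite -sqr_normc.
rewrite !sqrE pade_num_conj pade_den_conj.
have -> : (0 +i* y)^* = - (0 +i* y).
  by apply/eqP; rewrite eq_complex /= oppr0 !eqxx.
rewrite -horner_pade_stability_poly pade_stability_polyE //.
rewrite hornerZ hornerXn -(map_pade_num _ _ (real_complex R)) coef_map /=.
have -> : (0 +i* y) ^+ (q + q) = (-1) ^+ q * y%:C ^+ (q + q).
  rewrite addnn -mul2n !exprM -exprMn; congr (_ ^+ _).
  by apply/eqP; rewrite !expr2 eq_complex /=; apply/andP; split; apply/eqP; ring.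
have ee : (-1) ^+ q * (-1) ^+ q = 1 :> R[i].
  by rewrite -exprMn mulrNN mulr1 expr1n.
rewrite rmorph_nat -[RHS]mul1r -[X in _ = X * _]ee; move: ((-1) ^+ q) (y%:C ^+ _) => a b.
by ring.
Qed.

(** With t = q/(p+q), the summands are the rates that [sqr_normc_sub_ge] yields for D and N.
    Symmetry under t -> 1 - t makes the sum a polynomial in u = (t - 1/2)^2, and u <= 1/16. *)
Lemma dissipation_rate_pos (t : R) : 1 / 2%:R <= t <= 3%:R / 4%:R ->
  1 / 20%:R <= t * (2%:R - (1 + (t / 2%:R + t ^+ 2 / 6%:R)) ^+ 2)
  + (1 - t) * (2%:R - (1 + ((1 - t) / 2%:R + (1 - t) ^+ 2 / 6%:R)) ^+ 2).
Proof.
move=> /andP[t0 t1].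
have : (t - 1 / 2%:R) ^+ 2 <= 1 / 16%:R by nra.
have := sqr_ge0 (t - 1 / 2%:R).
set u := (t - _) ^+ 2 => u0 u1.
set r := (X in _ <= X).
have -> : r = 191%:R / 576%:R - 311%:R / 72%:R * u - 17%:R / 36%:R * u ^+ 2.
  by rewrite /r /u; field.
nra.
Qed.

Lemma pade_num0 p q : (pade_num R[i] p q)`_0 = 1.
Proof. by rewrite coef_pade_num !ffactn0 fact0 invr1 !mul1r. Qed.

Lemma pade_den0 p q : (pade_den R[i] p q)`_0 = 1.
Proof. by rewrite coef_comp_polyNX pade_num0 mulr1. Qed.

Lemma pade_num1 p q : (pade_num R[i] p q)`_1 = (p%:R / (p + q)%:R)%:C.
Proof. by rewrite coef_pade_num !ffactn1 invr1 mulr1 addnC fmorph_div /= !rmorph_nat. Qed.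

Lemma pade_den1 p q : (pade_den R[i] p q)`_1 = - (q%:R / (p + q)%:R)%:C.
Proof. by rewrite coef_comp_polyNX pade_num1 addnC mulN1r. Qed.

(** The constant 2/3 is t/2 + t^2/6 at t = 1; being below 1, it keeps D away from zero. *)
Lemma normc_pade_den_sub1_le p q w : normc w <= 1 / 2%:R ->
  normc ((pade_den R[i] p q).[w] - 1) <= 2%:R / 3%:R.
Proof.
move=> w2; set b := q%:R / (p + q)%:R : R.
have b0 : 0 <= b by rewrite divr_ge0.
have b1 : b <= 1.
  have [/eqP|pq0] := posnP (p + q).
    by rewrite addn_eq0 => /andP[_ /eqP q0]; rewrite /b q0 mul0r.
  by rewrite ler_pdivrMr ?ltr0n // mul1r ler_nat leq_addl.
have b01 : 0 <= b <= 1 by rewrite b0.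
have Pd j := normc_coef_pade_den_le p q j; rewrite -/b in Pd.
rewrite -(pade_den0 p q); apply: le_trans (normc_horner_subl_le _ _ _ b01 Pd _ w2) _.
nra.
Qed.

Lemma normc_gt0 w : w != 0 -> 0 < normc w.
Proof.
move=> w0; rewrite lt_neqAle normc_ge0 andbT eq_sym.
by apply: contra_neq w0; exact: eq0_normc.
Qed.

Lemma pade_den_neq0 p q w : normc w <= 1 / 2%:R ->
  (pade_den R[i] p q).[w] != 0.
Proof.
move=> /(normc_pade_den_sub1_le p q); apply: contraTneq => ->.
by rewrite sub0r normcN normc1 -ltNge; lra.
Qed.

Lemma sqr_normc_pade_den_le p q w : normc w <= 1 / 2%:R ->
  normc (pade_den R[i] p q).[w] ^+ 2 <= 4%:R.
Proof.
move=> /(normc_pade_den_sub1_le p q) h.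
have := @le_normcD R ((pade_den R[i] p q).[w] - 1) 1; rewrite subrK normc1.
have := normc_ge0 R (pade_den R[i] p q).[w].
move: (normc _) (normc _) h => A B; nra.
Qed.

(** The excess of |D|^2 over |N|^2 is split into a gain linear in -Re w and the exact excess at the
    projection i Im w. *)
Definition pade_dissipation p q w :=
  normc (pade_num R[i] p q).[w] ^+ 2 + - complex.Re w / 10%:R
  + (p < q)%N%:R * (pade_num R q p)`_q ^+ 2 * complex.Im w ^+ (q + q)
  <= normc (pade_den R[i] p q).[w] ^+ 2.

(** Moving horizontally from v = i Im w to w changes D and N to first order by b X and -a X, where X
    = -Re w. The two first-order effects add up to the rate of [dissipation_rate_pos]. *)
Lemma pade_dissipative_num_gt0 p q w : (0 < p)%N -> (p <= q <= p + 2)%N ->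
  normc w <= 1 / 2%:R -> complex.Re w <= 0 -> pade_dissipation p q w.
Proof.
move=> p0 pq w2 Rew.
have n0 : (0 < p + q)%N by lia.
set a := p%:R / (p + q)%:R : R; set b := q%:R / (p + q)%:R : R.
have nR : 0 < (p + q)%:R :> R by rewrite ltr0n.
have ab : a = 1 - b.
  apply: (mulIf (lt0r_neq0 nR)); rewrite mulrBl !divfK ?lt0r_neq0 //.
  by rewrite mul1r natrD addrK.
(* The upper bound says q <= 3p, which follows from q <= p + 2 and p >= 1. *)
have b1 : 1 / 2%:R <= b <= 3%:R / 4%:R.
  have h1 : (p + q)%:R <= 2%:R * q%:R :> R by rewrite -natrM ler_nat; lia.
  have h2 : 4%:R * q%:R <= 3%:R * (p + q)%:R :> R by rewrite -!natrM ler_nat; lia.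
  by rewrite /b (ler_pdivlMr _ _ nR) (ler_pdivrMr _ _ nR); apply/andP; split; lra.
have a01 : 0 <= a <= 1 by lra.
have b01 : 0 <= b <= 1 by lra.
set v := 0 +i* complex.Im w.
have v2 : normc v <= 1 / 2%:R.
  apply: le_trans w2; rewrite /v; case: (w) => x y /=.
  by rewrite ler_wsqrtr // expr0n add0r lerDr sqr_ge0.
have wv : w - v = (complex.Re w)%:C.
  by apply/eqP; rewrite eq_complex /v; case: (w) => x y /=; rewrite subr0 subrr !eqxx.
have X0 : 0 <= - complex.Re w by rewrite oppr_ge0.
set X := - complex.Re w in X0 *.
have Pn j := @normc_coef_pade_num_le p q j; rewrite -/a in Pn.
have Pd j := @normc_coef_pade_den_le p q j; rewrite -/b in Pd.
have nX : normc (w - v) = X by rewrite wv normc_real ler0_norm.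
have hD : 2%:R * (b * X) * (2%:R - (1 + (b / 2%:R + b ^+ 2 / 6%:R)) ^+ 2) <=
   normc (pade_den R[i] p q).[w] ^+ 2 - normc (pade_den R[i] p q).[v] ^+ 2.
  apply: sqr_normc_sub_ge.
  - by rewrite mulr_ge0 //; case/andP: b01.
  - by case/andP: b01 => ? _; rewrite addr_ge0 ?divr_ge0 ?exprn_ge0.
  - have := @normc_horner_taylor1_le _ _ _ b01 Pd _ _ w2 v2.
    by rewrite nX pade_den1 -/b wv mulNr -rmorphM -[b * complex.Re w]opprK -mulrN -/X rmorphN opprK.
  - by have := @normc_horner_subl_le _ _ _ b01 Pd _ w2; rewrite pade_den0.
  - by have := @normc_horner_subl_le _ _ _ b01 Pd _ v2; rewrite pade_den0.
have hN : 2%:R * (a * X) * (2%:R - (1 + (a / 2%:R + a ^+ 2 / 6%:R)) ^+ 2) <=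
   normc (pade_num R[i] p q).[v] ^+ 2 - normc (pade_num R[i] p q).[w] ^+ 2.
  apply: sqr_normc_sub_ge.
  - by rewrite mulr_ge0 //; case/andP: a01.
  - by case/andP: a01 => ? _; rewrite addr_ge0 ?divr_ge0 ?exprn_ge0.
  - have := @normc_horner_taylor1_le _ _ _ a01 Pn _ _ v2 w2.
    by rewrite -(opprB w) normcN nX pade_num1 -/a wv -rmorphN -/X -rmorphM.
  - by have := @normc_horner_subl_le _ _ _ a01 Pn _ v2; rewrite pade_num0.
  - by have := @normc_horner_subl_le _ _ _ a01 Pn _ w2; rewrite pade_num0.
rewrite /pade_dissipation.
have := @pade_imaginary_axis p q (complex.Im w) pq; rewrite -/v.
have := dissipation_rate_pos b b1; rewrite -ab -/X.
move: hD hN; set ga := 2%:R - _; set gb := 2%:R - _ => hD hN rate.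
have : 2%:R * X * (1 / 20%:R) <= 2%:R * X * (b * gb + a * ga).
  by rewrite ler_wpM2l // mulr_ge0.
have -> : 2%:R * X * (b * gb + a * ga) =
  2%:R * (b * X) * gb + 2%:R * (a * X) * ga by ring.
have -> : 2%:R * X * (1 / 20%:R) = X / 10%:R by field.
lra.
Qed.

(** For p = 0 the ratio q/(p+q) is 1, where the rate of [dissipation_rate_pos] is negative; here N =
    1 and D is computed explicitly. *)
Lemma pade_dissipative_num_eq0 q w : (0 < q <= 2)%N ->
  complex.Re w <= 0 -> pade_dissipation 0 q w.
Proof.
move=> q12 Rew.
have N1 : (pade_num R[i] 0 q).[w] = 1.
  suff -> : pade_num R[i] 0 q = 1 by rewrite hornerC.
  apply/polyP => -[|j]; first by rewrite pade_num0 coef1.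
  by rewrite coef_pade_num ffact_small // !mul0r coef1.
have num_coef k : (pade_num R k 0)`_k = k`!%:R^-1.
  by rewrite coef_pade_num add0n ffactnn divff ?mul1r // pnatr_eq0 -lt0n fact_gt0.
rewrite /pade_dissipation N1 normc1 expr1n num_coef.
rewrite (horner_coef_wide _ (size_pade_den _ 0 q)).
case: w Rew {N1} => x y /= x0.
have [->|->] : q = 1%N \/ q = 2%N by lia.
  rewrite !big_ord_recl big_ord0 lift0 pade_den0 pade_den1 divff ?oner_eq0 //.
  rewrite rmorph1 mul1r expr0 expr1 addr0 mulN1r invr1 sqr_normcE /=.
  nra.
rewrite !big_ord_recl big_ord0 !lift0 pade_den0 pade_den1 divff ?pnatr_eq0 //.
rewrite rmorph1 mul1r expr0 expr1 addr0 mulN1r.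
have -> : (pade_den R[i] 0 2)`_2 = (1 / 2%:R)%:C.
  rewrite coef_comp_polyNX expr2 mulrNN !mul1r.
  by rewrite -(map_pade_num _ _ (real_complex R)) coef_map num_coef.
rewrite sqr_normcE expr2 /=.
set d := (X in _ <= X); set g := (X in X <= _).
(* For q = 2, D = ((1 - w)^2 + 1)/2, so |D|^2 is a polynomial in 1 - x >= 1 and y. *)
have -> : d = g + x / 10%:R + ((1 - x) ^+ 4 + 2%:R * (1 - x) ^+ 2 - 3%:R) / 4%:R
  + y ^+ 2 * ((1 - x) ^+ 2 - 1) / 2%:R.
  by rewrite /d /g /= /factorial /=; field.
have h : 1 - 2%:R * x <= (1 - x) ^+ 2 by rewrite lerBlDr; nra.
have : 0 <= y ^+ 2 * ((1 - x) ^+ 2 - 1) by apply: mulr_ge0; [exact: sqr_ge0 | lra].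
have : 1 - 4%:R * x <= (1 - x) ^+ 4.
  by rewrite (exprM _ 2 2); nra.
lra.
Qed.

Theorem pade_dissipative p q w : (0 < q)%N -> (p <= q <= p + 2)%N ->
  normc w <= 1 / 2%:R -> complex.Re w <= 0 -> pade_dissipation p q w.
Proof.
case: p => [|p] q0 pq w2 Rew; last exact: pade_dissipative_num_gt0.
by apply: pade_dissipative_num_eq0 => //; lia.
Qed.

End LocalStability.

(** * Induced norms *)

Section InducedNorm.
Import Order.TTheory GRing.Theory Num.Theory Normc.
Local Open Scope classical_set_scope.
Local Open Scope complex_scope.
Local Open Scope ring_scope.

Variables (R : realType) (n : nat) (N : vector_norm R n).
Local Notation C := (Cfield R).
Implicit Types (x e v : 'cV[C]_n) (t : C).

Lemma vnormZ_normc t x : N (t *: x) = normc t * N x.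
Proof. by rewrite vnormZ. Qed.

Lemma vnorm_gt0 x : x != 0 -> 0 < N x.
Proof.
move=> x0; rewrite lt_neqAle vnorm_ge0 andbT eq_sym.
by apply: contra_neq x0; exact: vnorm_eq0.
Qed.

Lemma vnormN x : N (- x) = N x.
Proof. by rewrite -scaleN1r vnormZ_normc normcN normc1 mul1r. Qed.

Lemma normc_le_ReDIm (z : R[i]) : normc z <= `|complex.Re z| + `|complex.Im z|.
Proof.
case: z => a b /=; rewrite -[leRHS]ger0_norm ?addr_ge0 // -sqrtr_sqr ler_wsqrtr //.
rewrite -(real_normK (num_real a)) -(real_normK (num_real b)) sqrrD.
by rewrite lerD2r lerDl mulrn_wge0 // mulr_ge0.
Qed.

(* The pairwise bound [|t - s| N v <= N (e - t v) + N (e - s v)] makes the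
   intervals around the coordinates of [t] meet in a common point, at which the
   norm is within a factor 3 of its infimum. *)
Lemma vnorm_dist_line e v : (forall t, e - t *: v != 0) ->
  exists2 c, 0 < c & forall t, c <= N (e - t *: v).
Proof.
move=> ev.
have [v0|v0] := eqVneq v 0.
  exists (N e) => [|t]; last by rewrite v0 scaler0 subr0.
  by have := ev 0; rewrite scale0r subr0; exact: vnorm_gt0.
have m0 := vnorm_gt0 _ v0; set m := N v in m0.
pose r t := N (e - t *: v) / m.
have dist t s : normc (t - s) <= r t + r s.
  rewrite -mulrDl ler_pdivlMr // -vnormZ_normc.
  rewrite -(vnormN (e - t *: v)) (_ : _ *: v = - (e - t *: v) + (e - s *: v)) ?vnormD //.
  by rewrite scalerBl opprB addrA subrK.
(* One-dimensional Helly argument for a 1-Lipschitz p: the supremum of the left endpoints lies in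
   every interval. *)
have center (p : C -> R) : (forall t s, p t - p s <= normc (t - s)) ->
    exists a, forall t, `|p t - a| <= r t.
  move=> plip; set S := [set p t - r t | t in setT].
  have ub t s : p t - r t <= p s + r s.
    have := le_trans (plip t s) (dist t s).
    by move: (p t) (p s) (r t) (r s) => a b c d; lra.
  exists (sup S) => t; rewrite ler_norml; apply/andP; split.
    rewrite lerBrDr addrC lerBlDr; apply: ge_sup; first by exists (p t - r t), t.
    by move=> _ [s _ <-]; exact: ub.
  rewrite lerBlDl -lerBlDr; apply: ub_le_sup; last by exists t.
  by exists (p t + r t) => _ [s _ <-]; exact: ub.
have [a ha] : exists a, forall t, `|complex.Re t - a| <= r t.
  apply: center => t s; apply: le_trans (normc_Re_le _ _).
  by case: t s => ? ? [? ?] /=; exact: ler_norm.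
have [b hb] : exists b, forall t, `|complex.Im t - b| <= r t.
  apply: center => t s; apply: le_trans (normc_Im_le _ _).
  by case: t s => ? ? [? ?] /=; exact: ler_norm.
(* Since |t - t0| <= 2 r(t), the triangle inequality gives N(e - t0 v) <= 3 N(e - t v). *)
pose t0 : C := a +i* b.
exists (N (e - t0 *: v) / 3%:R) => [|t]; first by rewrite divr_gt0 ?vnorm_gt0.
rewrite ler_pdivrMr //.
have -> : e - t0 *: v = (e - t *: v) + (t - t0) *: v.
  by rewrite scalerBl addrA subrK.
apply: le_trans (vnormD _ _ _) _; rewrite vnormZ_normc.
have : normc (t - t0) <= r t + r t.
  apply: le_trans (normc_le_ReDIm _) _; apply: lerD.
    by have := ha t; rewrite /t0; case: (t).
  by have := hb t; rewrite /t0; case: (t).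
rewrite -(ler_pM2r m0) -mulrDl -/m divfK ?gt_eqF //.
lra.
Qed.

End InducedNorm.

(** * The scheme on the test equation *)

Section ScalarTestEquation.
Import Order.TTheory GRing.Theory Num.Theory Normc numFieldNormedType.Exports.
Local Open Scope classical_set_scope.
Local Open Scope complex_scope.
Local Open Scope ring_scope.

Variable R : realType.
Local Notation C := (Cfield R).
Implicit Types (y : 'cV[C]_1) (z w : C).

(* The linearization matrix of [x' = l x] at [y], stripped of the factor [l];
   it has rank one, with image spanned by [unit_col] and kernel [ker_col y]. *)
Definition ll_dir y : 'M[C]_(1 + 1) := block_mx 1%:M y 0 0.

Definition unit_col : 'cV[C]_(1 + 1) := col_mx 1%:M 0.

Definition ker_col y : 'cV[C]_(1 + 1) := col_mx (- y) 1%:M.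

(** The left eigenvector of [ll_dir y] for the eigenvalue 1; it annihilates [ker_col y]. *)
Definition ll_row y : 'M[C]_(1, 1 + 1) := row_mx 1%:M y.

Lemma ll_dirE y : ll_dir y = unit_col *m ll_row y.
Proof. by rewrite mul_col_row !mul1mx !mul0mx. Qed.

Lemma ll_row_unit_col y : ll_row y *m unit_col = 1%:M.
Proof. by rewrite mul_row_col mulmx1 mulmx0 addr0. Qed.

Lemma unit_col_neq0 : unit_col != 0.
Proof.
apply/eqP => /(congr1 (fun x : 'cV[C]_(1 + 1) => usubmx x 0 0)) /eqP.
by rewrite col_mxKu !mxE eqxx oner_eq0.
Qed.

Section Norms.
Variable N : vector_norm R (1 + 1).

(** If s = [ll_row y *m x] is nonzero, then x is s times a point of the affine line through
    [unit_col] along [ker_col y], whose norm is bounded below by [vnorm_dist_line]. *)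
Lemma ll_row_bounded y : exists2 K, 0 < K &
  forall x, normc ((ll_row y *m x) 0 0) <= K * N x.
Proof.
have ev t : unit_col - t *: ker_col y != 0.
  apply/eqP => h.
  have /(congr1 (fun x => (ll_row y *m x) 0 0)) /eqP := h.
  rewrite mulmxBr -scalemxAr ll_row_unit_col mul_row_col mul1mx mulmx1 addNr.
  by rewrite scaler0 subr0 mulmx0 !mxE eqxx oner_eq0.
have [c c0 hc] := vnorm_dist_line _ _ N _ _ ev.
exists c^-1 => [|x]; first by rewrite invr_gt0.
rewrite -ler_pdivrMl ?invr_gt0 // invrK.
set s := (ll_row y *m x) 0 0; set b := (dsubmx x) 0 0.
have [s0|s0] := eqVneq s 0; first by rewrite s0 normc0 mulr0 vnorm_ge0.
have -> : x = s *: (unit_col - (- (s^-1 * b)) *: ker_col y).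
  rewrite scaleNr opprK scalerDr scalerA mulrA divff // mul1r.
  rewrite !scale_col_mx add_col_mx scaler0 add0r.
  have -> : b *: 1%:M = dsubmx x.
    by apply/matrixP => i j; rewrite !ord1 mxE [X in _ * X]mxE eqxx mulr1.
  suff -> : s *: 1%:M + b *: - y = usubmx x by rewrite vsubmxK.
  apply/matrixP => i j; rewrite !ord1 /s -[x in ll_row y *m x]vsubmxK.
  rewrite mul_row_col mul1mx /b; move: (usubmx x) (dsubmx x) => x0 x1.
  by rewrite !mxE big_ord1 eqxx mulr1 mulrN [y 0 0 * _]mulrC addrK.
by rewrite vnormZ_normc mulrC ler_wpM2l ?normc_ge0.
Qed.

(** The lower bound tests the eigenvector [unit_col]; the upper one uses rank one and
    [ll_row_bounded]. Finiteness matters for both, as [sup] of an unbounded set is 0. *)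
Lemma induced_norm_ll_dir y : exists2 K, 0 < K & forall w,
  normc w <= induced_norm N (w *: ll_dir y) <= K * normc w.
Proof.
have [K K0 hK] := ll_row_bounded y.
have e0 := vnorm_gt0 _ _ N _ unit_col_neq0.
exists (K * N unit_col) => [|w]; first by rewrite mulr_gt0.
set S := [set N (w *: ll_dir y *m x) / N x | x in [set x | x != 0]].
have Nw x : N (w *: ll_dir y *m x)
    = normc w * (normc ((ll_row y *m x) 0 0) * N unit_col).
  rewrite -scalemxAl vnormZ_normc ll_dirE -mulmxA.
  by rewrite [X in _ *m X]mx11_scalar mul_mx_scalar vnormZ_normc.
have ub : ubound S (K * N unit_col * normc w).
  move=> _ [x x0 <-]; rewrite Nw ler_pdivrMr ?vnorm_gt0 //.
  rewrite mulrC [leRHS]mulrAC ler_wpM2r ?normc_ge0 // [leRHS]mulrAC ler_wpM2r ?vnorm_ge0 //.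
apply/andP; split; last first.
  apply: ge_sup => //; exists (normc w), unit_col; first exact: unit_col_neq0.
  rewrite Nw ll_row_unit_col !mxE eqxx mulr1n normc1 mul1r.
  by rewrite mulfK // gt_eqF.
apply: ub_le_sup; first by exists (K * N unit_col * normc w).
exists unit_col; first exact: unit_col_neq0.
rewrite Nw ll_row_unit_col !mxE eqxx mulr1n normc1 mul1r.
by rewrite mulfK // gt_eqF.
Qed.

End Norms.

Lemma jacobian_mx_scale (l : C) y :
  jacobian_mx (fun x : 'cV[C]_1 => l *: x) y = l%:M.
Proof.
apply/matrixP => i j; rewrite !ord1 !mxE eqxx mulr1n.
apply: norm_lim_near_cst; near=> h.
have h0 : h != 0 by near: h; exact: nbhs_dnbhs_neq.
rewrite /= !mxE !eqxx mulr1 mulrDr addrK [h^-1 *: _]mulrC.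
by rewrite -mulrA divff // mulr1.
Unshelve. all: by end_near.
Qed.

Lemma ll_mx_scale (l : C) y :
  ll_mx (fun x : 'cV[C]_1 => l *: x) y = l *: ll_dir y.
Proof.
by rewrite /ll_mx jacobian_mx_scale scale_block_mx !scaler0 scale_scalar_mx mulr1.
Qed.

Section Pade.
Variables p q : nat.

Lemma row_horner_mx m (u : 'rV[C]_m.+1) (A : 'M[C]_m.+1) (a : C) (P : {poly C}) :
  u *m A = a *: u -> u *m horner_mx A P = P.[a] *: u.
Proof.
move=> uA; elim/poly_ind: P => [|P c IH].
  by rewrite rmorph0 mulmx0 horner0 scale0r.
rewrite rmorphD rmorphM /= horner_mx_X horner_mx_C mulmxDr mulmxA IH.
by rewrite -scalemxAl uA scalerA mul_mx_scalar -scalerDl !hornerE.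
Qed.

(** The rows [ll_row y] and (0 1) are left eigenvectors of B for the eigenvalues w and 0, and both
    Padé polynomials are 1 at 0. *)
Lemma pade_mx_ll_dir y w : (pade_den C p q).[w] != 0 ->
  let B := w *: ll_dir y in
  ll_row y *m (@pade_mx C p q 1 B : 'M_(1 + 1))
    = ((pade_num C p q).[w] / (pade_den C p q).[w]) *: ll_row y /\
  row_mx 0 1%:M *m (@pade_mx C p q 1 B : 'M_(1 + 1)) = row_mx 0 1%:M.
Proof.
move=> Dw B; set D := horner_mx (B : 'M_2) (pade_den C p q).
have e1 : ll_row y *m B = w *: ll_row y.
  by rewrite -scalemxAr ll_dirE mulmxA ll_row_unit_col mul1mx.
have e0 : row_mx 0 1%:M *m B = 0 *: row_mx 0 1%:M.
  by rewrite -scalemxAr ll_dirE mulmxA mul_row_col mul0mx mulmx0 addr0 mul0mx scaler0 scale0r.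
have d1 : ll_row y *m (D : 'M_(1 + 1)) = (pade_den C p q).[w] *: ll_row y.
  exact: row_horner_mx e1.
have d0 : row_mx 0 1%:M *m (D : 'M_(1 + 1)) = row_mx 0 1%:M.
  rewrite (row_horner_mx _ _ _ _ _ e0) horner_coef0 (pade_den0 R p q).
  by rewrite scale1r.
have n1 : ll_row y *m (horner_mx (B : 'M_2) (pade_num C p q) : 'M_(1 + 1))
    = (pade_num C p q).[w] *: ll_row y by exact: row_horner_mx e1.
have n0 : row_mx 0 1%:M *m (horner_mx (B : 'M_2) (pade_num C p q) : 'M_(1 + 1))
    = row_mx 0 1%:M.
  rewrite (row_horner_mx _ _ _ _ _ e0) horner_coef0 (pade_num0 R p q).
  by rewrite scale1r.
(* In the unitriangular basis of these two rows, D becomes triangular with determinant D(w). *)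
have Du : (D : 'M_(1 + 1)) \in unitmx.
  have : col_mx (ll_row y) (row_mx 0 1%:M) *m (D : 'M_(1 + 1)) =
      block_mx (pade_den C p q).[w]%:M ((pade_den C p q).[w] *: y) 0 1%:M.
    by rewrite mul_col_mx d1 d0 scale_row_mx scale_scalar_mx mulr1.
  move/(congr1 determinant); rewrite det_mulmx !det_ublock !det1 mulr1 mul1r.
  by rewrite det_scalar1 mulr1 unitmxE => ->; rewrite unitfE.
rewrite /pade_mx -/D !mulmxA.
have i1 : ll_row y *m invmx (D : 'M_(1 + 1)) = (pade_den C p q).[w]^-1 *: ll_row y.
  rewrite -{1}[ll_row y]scale1r -(mulVf Dw) -scalerA -d1.
  by rewrite -scalemxAl mulmxK.
split; first by rewrite n1 -scalemxAl i1 scalerA.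
by rewrite n0 -{1}d0 mulmxK.
Qed.

Lemma row_mulmx_exp m (u : 'rV[C]_m.+1) (A : 'M[C]_m.+1) (a : C) k :
  u *m A = a *: u -> u *m (A ^+ k) = a ^+ k *: u.
Proof.
move=> uA; elim: k => [|k IH]; first by rewrite !expr0 mulmx1 scale1r.
by rewrite exprSr mulmxA IH -scalemxAl uA scalerA -exprSr.
Qed.

Variables (N : vector_norm R (1 + 1)).

Definition scaling y z : nat := kappa N (z *: ll_dir y).

Definition scaled y z : C := (2 ^- scaling y z)%:C * z.

Definition pade_factor y z : C :=
  ((pade_num C p q).[scaled y z] / (pade_den C p q).[scaled y z])
    ^+ (2 ^ scaling y z).

Lemma ll_phi_scale (l : C) (h : R) y :
  (pade_den C p q).[scaled y (h%:C * l)] != 0 ->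
  @ll_phi R 0 p q N (fun x => l *: x) y h = pade_factor y (h%:C * l) *: y - y.
Proof.
move=> Dw; rewrite /ll_phi ll_mx_scale.
rewrite (scalerA h%:C l).
rewrite (scalerA _ (h%:C * l)).
rewrite -/(scaling y (h%:C * l)).
rewrite -/(scaled y (h%:C * l)).
have [M1 M0] := pade_mx_ll_dir y _ Dw.
set M := @pade_mx C p q 1 (scaled y (h%:C * l) *: ll_dir y) in M1 M0 *.
rewrite -/M.
(* Expanded in left eigenvectors, so that powers of M act by powers of the eigenvalues. *)
have -> : row_mx 1%:M 0 = ll_row y - y *m row_mx 0 1%:M.
  by rewrite mul_mx_row mulmx0 mulmx1 opp_row_mx add_row_mx oppr0 addr0 subrr.
set k := scaling y _.
have Mk1 : ll_row y *m (M ^+ (2 ^ k) : 'M_(1 + 1)) = pade_factor y (h%:C * l) *: ll_row y.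
  exact: row_mulmx_exp M1.
have Mk0 : row_mx 0 1%:M *m (M ^+ (2 ^ k) : 'M_(1 + 1)) = row_mx 0 1%:M.
  have M0' : row_mx 0 1%:M *m (M : 'M_(1 + 1)) = 1 *: row_mx 0 1%:M by rewrite scale1r.
  by have := row_mulmx_exp _ _ _ _ (2 ^ k) M0'; rewrite expr1n scale1r.
rewrite !mulmxBl Mk1 -!mulmxA [row_mx 0 1%:M *m (_ *m _)]mulmxA Mk0 -scalemxAl.
by rewrite !mul_row_col !mul0mx !mulmx0 !mulmx1 !add0r mulmx1.
Qed.

(** Linearity of f reduces [ll_q] to l xi, so every stage vanishes by induction on its index, and
    only [ll_phi] contributes. *)
Lemma LLRK_scale (s : nat) (c b : 'I_s -> R) (a : 'M[R]_s) (l : C) (h : R) y :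
  (pade_den C p q).[scaled y (h%:C * l)] != 0 ->
  @LLRK R 0 p q N s c b a (fun x => l *: x) h y = pade_factor y (h%:C * l) *: y.
Proof.
move=> Dw; set f := fun x : 'cV[C]_1 => l *: x.
have qE t xi : @ll_q R 0 p q N f y t xi = l *: xi.
  rewrite /ll_q jacobian_mx_scale mul_scalar_mx /f; move: (ll_phi _ _ _ _ _ _) => phi.
  rewrite -!scalerBr; congr (_ *: _).
  by rewrite -addrA -opprD [phi + y]addrC addrAC subrr add0r.
have stage0 : @rk_stage R 0 p q N s c a f y h = fun=> 0.
  apply/funext => i; have [m] := ubnP i; elim: m i => // m IH i im.
  rewrite rk_stageE /rk_stage_step qE big1 ?scaler0 // => j ji.
  by rewrite IH ?scaler0 //; lia.
rewrite /LLRK /rk_rho stage0 big1 ?scaler0 ?addr0 => [|i _]; last exact: scaler0.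
by rewrite ll_phi_scale // addrCA subrr addr0.
Qed.

Lemma normc_scaled_le y z : normc (scaled y z) <= 1 / 2%:R.
Proof.
rewrite /scaled /scaling /kappa; case: ex_minnP => k hk _.
have [K _ hK] := induced_norm_ll_dir N y.
apply: le_trans (proj1 (andP (hK _))) _.
by rewrite -scalerA div1r.
Qed.

(** By minimality, halving once less leaves a norm above 1/2, so 2 K |w| > 1/2; hence r = 1/(4K),
    which depends on y alone. *)
Lemma normc_scaled_ge y : exists2 r, 0 < r &
  forall z, (0 < scaling y z)%N -> r <= normc (scaled y z).
Proof.
have [K K0 hK] := induced_norm_ll_dir N y.
exists (4%:R * K)^-1 => [|z]; first by rewrite invr_gt0 mulr_gt0.
rewrite /scaled /scaling /kappa; case: ex_minnP => -[//|k] _ kmin _.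
have : 2^-1 < normc ((2 ^- k)%:C * z) * K.
  rewrite mulrC; apply: lt_le_trans (proj2 (andP (hK _))).
  by rewrite ltNge -scalerA; apply/negP => /kmin; rewrite ltnn.
rewrite !normcM !normc_real !ger0_norm ?invr_ge0 ?exprn_ge0 //.
rewrite -[(4%:R * K)^-1]mul1r ler_pdivrMr ?mulr_gt0 // exprS invfM => h.
apply/ltW; move: h; move: (2 ^- k) (normc z) => u v; lra.
Qed.

End Pade.

Lemma pade_ratio_le1 p q w : (p <= q <= p + 2)%N ->
  normc w <= 1 / 2%:R -> complex.Re w <= 0 ->
  normc ((pade_num C p q).[w] / (pade_den C p q).[w]) <= 1.
Proof.
move=> pq w2 Rew; have D0 := pade_den_neq0 R p q w w2.
have nD0 := normc_gt0 R _ D0.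
rewrite normcM normcV ler_pdivrMr // mul1r.
(* For q = 0 also p = 0; both polynomials are 1 and the linear gain fails, so this case is treated
   apart. *)
case: q pq D0 nD0 => [|q] pq D0 nD0.
  have {pq} -> : p = 0%N by lia.
  rewrite (horner_coef_wide _ (size_pade_den _ 0 0)).
  rewrite (horner_coef_wide _ (size_pade_num _ 0 0)).
  by rewrite !big_ord_recl !big_ord0 (pade_den0 R) (pade_num0 R).
rewrite -ler_sqr ?nnegrE ?normc_ge0 //.
apply: le_trans (pade_dissipative R p q.+1 w isT pq w2 Rew).
rewrite -addrA lerDl; apply: addr_ge0; first by rewrite divr_ge0 ?oppr_ge0.
rewrite addnn -mul2n exprM; apply: mulr_ge0; last exact/exprn_ge0/sqr_ge0.
by apply: mulr_ge0 => //; exact: sqr_ge0.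
Qed.

Lemma pade_ratio_lt1 p q (r : R) : (p < q <= p + 2)%N -> 0 < r ->
  exists2 th, 0 <= th < 1 & forall w, r <= normc w ->
    normc w <= 1 / 2%:R -> complex.Re w <= 0 ->
    normc ((pade_num C p q).[w] / (pade_den C p q).[w]) ^+ 2 <= th.
Proof.
move=> pq r0.
have pq' : (p <= q <= p + 2)%N by lia.
have q0 : (0 < q)%N by lia.
set d := (pade_num R q p)`_q.
have d0 : 0 < d.
  by rewrite /d coef_pade_num !divr_gt0 ?ltr0n ?ffact_gt0 ?fact_gt0 //; lia.
(* Either |Re w| or |Im w| is at least r/2, and g bounds the gain in each case. With |D|^2 <= 4 this
   yields the factor 1 - g/4; the cap at 1 keeps it nonnegative. *)
pose g := Num.min 1 (Num.min (r / 20%:R) (d ^+ 2 * (r / 2%:R) ^+ (q + q))).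
have g0 : 0 < g.
  by rewrite !lt_min ltr01 divr_gt0 // mulr_gt0 ?exprn_gt0 // divr_gt0.
have g1 : g <= 1 by rewrite ge_min lexx.
exists (1 - g / 4%:R) => [|w rw w2 Rew]; first by lra.
have D0 := pade_den_neq0 R p q w w2.
have nD0 := normc_gt0 R _ D0.
have D2 := sqr_normc_pade_den_le R p q w w2.
rewrite normcM normcV exprMn exprVn ler_pdivrMr ?exprn_gt0 //.
have := pade_dissipative R p q w q0 pq' w2 Rew.
rewrite /pade_dissipation (proj1 (andP pq)) mul1r -/d.
have := normc_le_ReDIm R w.
move: (complex.Re w) (complex.Im w) Rew => x y x0 rxy.
have y0 : 0 <= d ^+ 2 * y ^+ (q + q).
  rewrite addnn -mul2n exprM; apply: mulr_ge0; first exact: sqr_ge0.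
  exact/exprn_ge0/sqr_ge0.
have : g <= - x / 10%:R + d ^+ 2 * y ^+ (q + q).
  have [rx|xr] := leP (r / 2%:R) `|x|.
    apply: le_trans (_ : r / 20%:R <= _); first by rewrite !ge_min lexx orbT.
    by move: rx; rewrite ler0_norm //; lra.
  have ry : r / 2%:R <= `|y| by lra.
  apply: le_trans (_ : d ^+ 2 * (r / 2%:R) ^+ (q + q) <= _).
    by rewrite !ge_min lexx !orbT.
  have : d ^+ 2 * (r / 2%:R) ^+ (q + q) <= d ^+ 2 * y ^+ (q + q).
    rewrite ler_wpM2l ?sqr_ge0 // addnn -mul2n !exprM -(real_normK (num_real y)).
    by rewrite !lerXn2r ?nnegrE ?sqr_ge0 ?normr_ge0 ?divr_ge0 ?(ltW r0).
  lra.
move: D2; move: (normc _ ^+ 2) (normc _ ^+ 2) (d ^+ 2 * _) => A B E; nra.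
Qed.

Lemma exists_expr_lt (th e : R) : 0 <= th < 1 -> 0 < e ->
  exists m, th ^+ m < e.
Proof.
move=> /andP[th0 th1] e0.
have th1' : `|th| < 1 by rewrite ger0_norm.
have /cvgrPdist_lt /(_ _ e0) [m _ /(_ m (leqnn m))] := cvg_expr th1'.
by rewrite sub0r normrN ger0_norm ?exprn_ge0 //; exists m.
Qed.

End ScalarTestEquation.

(** * Contractivity and damping of the amplification factor *)

Section Stability.
Import Order.TTheory GRing.Theory Num.Theory Normc numFieldNormedType.Exports.
Local Open Scope complex_scope.
Local Open Scope ring_scope.

Variables (R : realType) (p q : nat) (N : vector_norm R (1 + 1)).
Local Notation C := (Cfield R).

Definition LLRK_factor (l : C) (h : R) (y : 'cV[C]_1) : C :=
  pade_factor R p q N y (h%:C * l).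

Lemma Re_realM (t : R) (z : C) : complex.Re (t%:C * z) = t * complex.Re z.
Proof. by case: z => a b /=; rewrite mul0r subr0. Qed.

Lemma scaled_Re_le0 y (l : C) (h : R) : complex.Re l <= 0 -> 0 < h ->
  complex.Re (scaled R N y (h%:C * l)) <= 0.
Proof.
move=> Rel h0; rewrite /scaled !Re_realM mulr_ge0_le0 ?invr_ge0 ?exprn_ge0 //.
by rewrite mulr_ge0_le0 // ltW.
Qed.

Lemma LLRK_factorE (s : nat) (c b : 'I_s -> R) (a : 'M[R]_s) :
  stability_factor (@LLRK R 0 p q N s c b a) LLRK_factor.
Proof.
move=> l h y _ _; apply: LLRK_scale.
exact: pade_den_neq0 (normc_scaled_le _ _ _ _).
Qed.

Lemma LLRK_factor_contractive : (p <= q <= p + 2)%N -> contractive LLRK_factor.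
Proof.
move=> pq l h y Rel h0.
rewrite normCE -[1]/(1%:C) lecR /LLRK_factor /pade_factor normcX.
rewrite exprn_ile1 ?normc_ge0 //; apply: pade_ratio_le1 => //.
  exact: normc_scaled_le.
exact: scaled_Re_le0.
Qed.

Lemma LLRK_factor_damping : (p < q <= p + 2)%N -> damping LLRK_factor.
Proof.
move=> pq y e e0.
have [r r0 hr] := normc_scaled_ge _ N y.
have [th th01 hth] := pade_ratio_lt1 R p q r pq r0.
(* The target is e^2 because [th] bounds the squared modulus. *)
have [m hm] := exists_expr_lt _ _ _ th01 (exprn_gt0 2 e0).
(* As |z| <= 2^k / 2, this threshold forces 2^k >= m; the added 1 forces k > 0 even when m = 0. *)
exists (m%:R + 1) => l h Rel h0.
rewrite normCE ltcR normCE ltcR; set z := h%:C * l => zM.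
have w2 := normc_scaled_le R N y z.
have zE : normc z = 2 ^+ scaling R N y z * normc (scaled R N y z).
  rewrite /scaled normcM normc_real ger0_norm ?invr_ge0 ?exprn_ge0 //.
  by rewrite mulrA divff ?mul1r // expf_neq0 // pnatr_eq0.
have m0 : 0 <= m%:R :> R by [].
have k0 : (0 < scaling R N y z)%N.
  rewrite lt0n; apply: contraTneq zM => k0; rewrite -leNgt zE k0 expr0 mul1r.
  by apply: le_trans w2 _; rewrite natr1 ler_pdivrMr // -natrM ler1n muln_gt0.
have mk : (m <= 2 ^ scaling R N y z)%N.
  rewrite -(ler_nat R) natrX.
  apply: (@le_trans _ _ (m%:R + 1)); first by rewrite lerDl.
  apply/ltW/(lt_le_trans zM); rewrite zE ler_piMr ?exprn_ge0 //.
  by apply: le_trans w2 _; rewrite ler_pdivrMr // mul1r ler1n.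
have hw := hth _ (hr _ k0) w2 (scaled_Re_le0 y l h Rel h0).
rewrite -ltr_sqr ?nnegrE ?normc_ge0 ?ltW //.
apply: le_lt_trans hm; rewrite /LLRK_factor /pade_factor normcX -exprM mulnC exprM.
case/andP: th01 => th0 th1.
apply: le_trans (_ : th ^+ (2 ^ scaling R N y z) <= _).
  by rewrite lerXn2r ?nnegrE ?exprn_ge0 ?normc_ge0.
by rewrite ler_wiXn2l // ltW.
Qed.

End Stability.

Theorem theorem17 (R : realType) (p q : nat) (N : vector_norm R (1 + 1))
    (s : nat) (c b : 'I_s -> R) (a : 'M[R]_s) :
  p <= q <= p + 2 ->
  A_stable (@LLRK R 0 p q N s c b a) /\
  (q = p + 1 \/ q = p + 2 -> L_stable (@LLRK R 0 p q N s c b a)).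
Proof.
move=> pq; have ctr := LLRK_factor_contractive R p q N pq.
split; first by exists (LLRK_factor R p q N); split; [exact: LLRK_factorE|].
move=> qp; exists (LLRK_factor R p q N); split=> //; first exact: LLRK_factorE.
by apply: LLRK_factor_damping; lia.
Qed.
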